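(* Let $\mathbb{M}\subset\mathbb{N}$, let $l\geq 2$ be a fixed integer, and let $n\in\mathbb{N}$. If $\mathcal{E}(l,\mathbb{M})=\infty$, then the circle of partition $\mathcal{C}(n^l,\mathbb{M})$ is ascending at infinitely many spots, i.e. there are infinitely many $m>n^l$ with $\nu(n^l,\mathbb{M})<\nu(m,\mathbb{M})$.
   Context: $\mathbb{N}=\{1,2,\dots\}$. For $n\in\mathbb{N}$ and $\mathbb{M}\subseteq\mathbb{N}$, the circle of partition is $\mathcal{C}(n,\mathbb{M})=\{[x]: x,y\in\mathbb{M},\ x+y=n\}$. An axis of $\mathcal{C}(n,\mathbb{M})$ is an unordered pair of distinct points $[x],[y]\in\mathcal{C}(n,\mathbb{M})$ with $x+y=n$ (the center $[n/2]$, if present, is not an axis point), and $\nu(n,\mathbb{M})$ is the number of axes, i.e. the number of unordered pairs $\{x,y\}\subseteq\mathbb{M}$ with $x\neq y$, $x+y=n$. $\mathcal{C}(n,\mathbb{M})$ is called ascending from $n$ to the spot $m$ if $n<m$ and $\nu(n,\mathbb{M})<\nu(m,\mathbb{M})$. For fixed $l\in\mathbb{N}$ the $l$-th fold energy is $$\mathcal{E}(l,\mathbb{M}):=\sum_{n=3}^{\infty}\frac{\nu(n^l,\mathbb{M})}{\left\lfloor\frac{n^l-1}{2}\right\rfloor}\in[0,\infty].$$ *)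

(* Defs.v *)
From HB Require Import structures.
From mathcomp Require Import all_boot all_order all_algebra.
From mathcomp Require Import finmap.
From mathcomp Require Import all_classical all_reals all_analysis.

Set Implicit Arguments.
Unset Strict Implicit.
Unset Printing Implicit Defensive.

Import Order.TTheory GRing.Theory Num.Theory.
Local Open Scope classical_set_scope.

(* The point [x] is identified with its weight x.  The sets M are sets of
   natural numbers; that they avoid 0 (N starts at 1) is a hypothesis wherever
   it is needed. *)
Definition cop (n : nat) (M : set nat) : set nat :=
  [set x | exists y, [/\ M x, M y & x + y = n]%N].

(* An axis is the two-element set of its endpoints, so that it is unordered. *)
Definition axes (n : nat) (M : set nat) : set (set nat) :=
  [set A | exists x y, [/\ cop n M x, cop n M y, x <> y, (x + y)%N = n
                         & A = [set x; y]]].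

(* fset_set sends infinite sets to the empty one; finite_axes below shows that
   this never happens here. *)
Definition nu (n : nat) (M : set nat) : nat := #|` fset_set (axes n M)|%fset.

Lemma finite_axes (n : nat) (M : set nat) : finite_set (axes n M).
Proof.
apply: (@sub_finite_set _ _ ((fun x => [set x; (n - x)%N]) @` `I_n.+1)).
  move=> A [x] [y] [_ _ _ <- ->]; exists x; first by rewrite /= ltnS leq_addr.
  by rewrite addKn.
exact/finite_image/finite_II.
Qed.

Definition ascending (n m : nat) (M : set nat) : Prop :=
  (n < m)%N /\ (nu n M < nu m M)%N.

Definition fold_energy (R : realType) (l : nat) (M : set nat) : \bar R :=
  (\sum_(3 <= k <oo) ((nu (k ^ l) M)%:R / ((k ^ l - 1) %/ 2)%N%:R)%R%:E)%E.

(* Main.v *)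
(** If only finitely many spots were ascending, [nu _ M] would be bounded; since
    [l >= 2], the energy would then be dominated by a multiple of the telescoping
    series of terms [2 / (k (k - 1))], hence finite. *)
Require Import Defs.
From HB Require Import structures.
From mathcomp Require Import all_boot all_order all_algebra.
From mathcomp Require Import finmap.
From mathcomp Require Import all_classical all_reals all_analysis.
From mathcomp Require Import zify ring lra.
Local Open Scope classical_set_scope.

Import Order.TTheory GRing.Theory Num.Theory.

Lemma bounded_outside_finite (f : nat -> nat) (a : nat) (A : set nat) :
  finite_set A -> (forall m, ~ A m -> (f m <= a)%N) ->
  exists B, forall m, (f m <= B)%N.
Proof.
move=> finA fa.
exists (maxn a (\max_(m <- fset_set A) f m)) => m; rewrite leq_max.
have [Am|nAm] := pselect (A m); last by rewrite fa.
by apply/orP; right; apply: leq_bigmax_seq; rewrite // in_fset_set // inE.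
Qed.

(** Since [k * k.-1] is even and at most [k ^ 2 - 1], hence at most [k ^ l - 1], the floor in the
    halving costs nothing. *)
Lemma leq_half_pow (l k : nat) : (2 <= l)%N -> (0 < k)%N ->
  (k * k.-1 <= 2 * ((k ^ l - 1) %/ 2))%N.
Proof.
move=> hl k0.
have : (k ^ 2 <= k ^ l)%N by rewrite leq_pexp2l.
have : ~~ odd (k * k.-1) by case: k k0 => // k _; rewrite oddM /=; case: odd.
move: (k ^ l)%N => p; rewrite -mulnn; case: k k0 => // k _ /=.
lia.
Qed.

(** The factor of [B] is the exact value of the telescoping sum of [2 / (k - 1) - 2 / k] over
    [3 <= k < N + 3]; keeping the remainder [2 / (N + 2)] lets the induction close. *)
Lemma fold_energy_partial_le (R : realType) (l B N : nat) (M : set nat) :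
  (2 <= l)%N -> (forall m, (nu m M <= B)%N) ->
  (\sum_(3 <= k < N + 3) (nu (k ^ l) M)%:R / ((k ^ l - 1) %/ 2)%N%:R
    <= B%:R * (1 - 2 / (N + 2)%:R) :> R)%R.
Proof.
move=> hl hB; elim: N => [|N IH].
  by rewrite big_geq // divff ?pnatr_eq0// subrr mulr0.
rewrite addSn big_nat_recr ?leq_addl //=; set k := (N + 3)%N; set D := (_ %/ 2)%N.
have hD : (k * k.-1 <= 2 * D)%N by apply: leq_half_pow; rewrite // /k addn3.
have hD' : ((N + 3)%:R * (N + 2)%:R <= 2 * D%:R :> R)%R.
  by rewrite -!natrM ler_nat; move: hD; rewrite /k !addnS.
have D0 : (0 < D%:R :> R)%R.
  by rewrite ltr0n lt0n; apply: contraTneq hD => ->; rewrite /k !addnS.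
(* With [k = N + 3], the right-hand side is [2 / (k * (k - 1))]. *)
have inv : (D%:R^-1 <= 2 / (N + 2)%:R - 2 / (N + 3)%:R :> R)%R.
  have -> : (2 / (N + 2)%:R - 2 / (N + 3)%:R
            = ((N + 3)%:R * (N + 2)%:R / 2)^-1 :> R)%R.
    by rewrite !natrD; field; rewrite -!natrD !pnatr_eq0 !addnS.
  by rewrite lef_pV2 ?posrE // ler_pdivrMr // [leRHS]mulrC.
have term : ((nu (k ^ l) M)%:R / D%:R
    <= B%:R * (2 / (N + 2)%:R - 2 / (N + 3)%:R) :> R)%R.
  by apply: ler_pM => //; rewrite ?invr_ge0 ?ler_nat // ltW.
apply: le_trans (lerD IH term) _.
by rewrite -mulrDr addSnnS; apply: ler_wpM2l => //; lra.
Qed.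

Lemma fold_energy_bounded (R : realType) (l B : nat) (M : set nat) :
  (2 <= l)%N -> (forall m, (nu m M <= B)%N) ->
  (fold_energy R l M <= B%:R%:E)%E.
Proof.
move=> hl hB; apply: lime_le.
  by apply: is_cvg_nneseries => k _ _; rewrite lee_fin divr_ge0.
apply: nearW => N; rewrite sumEFin lee_fin.
(* Partial sums ending at or before index 3 are empty; otherwise [N] is written as [(N - 3) + 3]. *)
have [N3|/ltnW N3] := leqP 3 N; last by rewrite big_geq.
rewrite -(subnK N3); apply: le_trans (fold_energy_partial_le R l B (N - 3) M hl hB) _.
by rewrite ler_piMr // gerBl divr_ge0.
Qed.

Theorem proposition6p3 (R : realType) (M : set nat) (l n : nat)
  (hM : M `<=` [set k | (0 < k)%N]) (hl : (2 <= l)%N) (hn : (0 < n)%N)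
  (hE : fold_energy R l M = +oo%E) :
  infinite_set [set m | ascending (n ^ l) m M].
Proof.
move=> fin_asc.
(* A spot can fail to be ascending merely because [m <= n ^ l], so these finitely many [m] join the
   exceptional set; outside it, [nu m M <= nu (n ^ l) M]. *)
have [|m nA|B hB] := @bounded_outside_finite (nu^~ M) (nu (n ^ l) M)
  (`I_(n ^ l).+1 `|` [set m | ascending (n ^ l) m M]).
- by rewrite finite_setU; split; first exact: finite_II.
- rewrite leqNgt; apply/negP => lt_nu; apply: nA.
  by have [le_m|lt_m] := leqP m (n ^ l); [left|right].
- by have := fold_energy_bounded R l B M hl hB; rewrite hE.
Qed.
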